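(* Let $K\in\mathbb{R}$ and $K_s>0$ with $K/K_s\neq -2$ (so that all but one value of the parameter ratio $K/K_s$ is allowed). Let $\theta\in\Theta$ be a fixed point of the dynamics $$\partial_t\theta(x)=K\int_0^1\sin(\theta(x)-\theta(y))\,\mathrm{d}y-K_s\sin(2\theta(x)).$$ If $\theta$ is a directional local minimum of the energy $$E(\theta)=\frac K2\int_0^1\!\!\int_0^1\cos(\theta(x)-\theta(y))\,\mathrm{d}x\,\mathrm{d}y-\frac{K_s}{2}\int_0^1\cos(2\theta(x))\,\mathrm{d}x,$$ then $\theta(x)\in\{0,\pi\}$ for almost every $x\in[0,1]$.
   Context: $\mathbb{T}=\mathbb{R}/2\pi\mathbb{Z}$. $\Theta$ is the set of measurable functions $\theta:[0,1]\to\mathbb{T}$, identified when equal almost everywhere. For $\theta\in\Theta$ and $p\in L^2([0,1];\mathbb{R})$, $\theta+p\in\Theta$ is defined pointwise modulo $2\pi$. A fixed point is a $\theta\in\Theta$ for which the right-hand side of the dynamics vanishes for almost every $x$. A point $\theta\in\Theta$ is a directional local minimum of $E$ if for every $p\in L^2([0,1];\mathbb{R})$ there exists $\varepsilon_p>0$ such that $E(\theta+hp)\ge E(\theta)$ for all $|h|<\varepsilon_p$. *)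

(* Defs.v *)
From HB Require Import structures.
From mathcomp Require Import all_boot all_order all_algebra.
From mathcomp Require Import generic_quotient ring_quotient.
From mathcomp Require Import all_classical all_reals all_analysis.

Set Implicit Arguments.
Unset Strict Implicit.
Unset Printing Implicit Defensive.
Import Order.TTheory GRing.Theory Num.Theory.
Import numFieldNormedType.Exports.
Local Open Scope classical_set_scope.
Local Open Scope ring_scope.
Local Open Scope quotient_scope.

Definition twopiZ (R : realType) : {pred R} :=
  fun x => `[< exists k : int, x = k%:~R * (2 * pi) >].

Lemma twopiZ_closed (R : realType) : zmod_closed (@twopiZ R).
Proof.
split; first by apply/asboolP; exists 0; rewrite mul0r.
move=> x y /asboolP [k ->] /asboolP [l ->]; apply/asboolP; exists (k - l).
by rewrite intrB mulrBl.
Qed.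

HB.instance Definition _ (R : realType) :=
  GRing.isZmodClosed.Build R (@twopiZ R) (@twopiZ_closed R).

(* [circle R] is the additive group R / 2 pi Z, with the quotient topology and
   its Borel sigma-algebra. *)
Definition circle (R : realType) : Type :=
  quotient_topology (Quotient.quot (@twopiZ R)).

HB.instance Definition _ (R : realType) := Quotient.on (circle R).
HB.instance Definition _ (R : realType) := PointedTopological.on (circle R).

(* The group structure is rebuilt rather than copied from [Quotient.quot]
   because the choice structures of [Quotient.quot] and [quotient_topology]
   differ. *)
HB.instance Definition _ (R : realType) :=
  GRing.isZmodule.Build (circle R)
    (@Quotient.addqA R (@twopiZ R)) (@Quotient.addqC R (@twopiZ R))
    (@Quotient.add0q R (@twopiZ R)) (@Quotient.addNq R (@twopiZ R)).

HB.instance Definition _ (R : realType) :=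
  Measurable.copy (circle R) (g_sigma_algebraType (@open (circle R))).

Definition tocircle (R : realType) (x : R) : circle R := \pi_(circle R) x.

Definition csin (R : realType) (t : circle R) : R := sin (repr t).
Definition ccos (R : realType) (t : circle R) : R := cos (repr t).

Lemma tocircleD (R : realType) (x y : R) :
  tocircle (x + y) = tocircle x + tocircle y.
Proof. exact: (@Quotient.pi_add R (@twopiZ R)). Qed.

Lemma tocircleN (R : realType) (x : R) : tocircle (- x) = - tocircle x.
Proof. exact: (@Quotient.pi_opp R (@twopiZ R)). Qed.

Lemma tocircle_eqP (R : realType) (x y : R) :
  tocircle x = tocircle y <-> exists k : int, x - y = k%:~R * (2 * pi).
Proof.
split=> [h|h].
- have /asboolP : (x - y) \in @twopiZ R; last by [].
  by rewrite Quotient.idealrBE; exact/eqP/h.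
- suff : (x - y) \in @twopiZ R by rewrite Quotient.idealrBE => /eqP.
  exact/asboolP.
Qed.

Lemma sinDzpi (R : realType) (x : R) (k : int) :
  sin (x + k%:~R * (2 * pi)) = sin x.
Proof.
have nat_case (n : nat) (y : R) : sin (y + n%:R * (2 * pi)) = sin y.
  by rewrite mulr_natl [2 * pi]mulr_natl (periodicn (@sinD2pi R)).
case: k => n; first by rewrite -[Posz n]/(n%:Z) -pmulrn nat_case.
by rewrite NegzE mulrNz mulNr -(nat_case n.+1) -pmulrn subrK.
Qed.

Lemma cosDzpi (R : realType) (x : R) (k : int) :
  cos (x + k%:~R * (2 * pi)) = cos x.
Proof.
have nat_case (n : nat) (y : R) : cos (y + n%:R * (2 * pi)) = cos y.
  by rewrite mulr_natl [2 * pi]mulr_natl (periodicn (@cosD2pi R)).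
case: k => n; first by rewrite -[Posz n]/(n%:Z) -pmulrn nat_case.
by rewrite NegzE mulrNz mulNr -(nat_case n.+1) -pmulrn subrK.
Qed.

Lemma csin_tocircle (R : realType) (x : R) : csin (tocircle x) = sin x.
Proof.
have /tocircle_eqP[k hk] : tocircle (repr (tocircle x)) = tocircle x.
  exact: reprK.
by rewrite /csin -(sinDzpi x k) -hk addrC subrK.
Qed.

Lemma ccos_tocircle (R : realType) (x : R) : ccos (tocircle x) = cos x.
Proof.
have /tocircle_eqP[k hk] : tocircle (repr (tocircle x)) = tocircle x.
  exact: reprK.
by rewrite /ccos -(cosDzpi x k) -hk addrC subrK.
Qed.

Section Dynamics.
Context {R : realType}.
Implicit Types (K Ks : R) (theta : R -> circle R) (p : R -> R).

Local Notation mu := (@lebesgue_measure R).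

(* Functions on [0,1] are represented by functions on R of which only the
   values on [0,1] matter. Elements of [Theta] are representatives: every
   notion below is invariant under almost everywhere equality on [0,1].
   Measurability is Borel measurability, which yields the same classes modulo
   almost everywhere equality as Lebesgue measurability. *)
Definition Theta : set (R -> circle R) :=
  [set theta | measurable_fun (`[0, 1] : set R) theta].

Definition L2_01 : set (R -> R) :=
  [set p : R -> R | p \_ `[0, 1] \in Lfun mu 2%:E].

Definition perturb theta p : R -> circle R :=
  fun x => theta x + tocircle (p x).

Definition rhs K Ks theta (x : R) : R :=
  K * (\int[mu]_(y in `[0, 1]) csin (theta x - theta y))
  - Ks * csin (theta x *+ 2).

Definition fixed_point K Ks theta : Prop :=
  {ae mu, forall x, x \in `[0, 1] -> rhs K Ks theta x = 0}.

Definition energy K Ks theta : R :=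
  K / 2 * (\int[mu]_(y in `[0, 1])
             \int[mu]_(x in `[0, 1]) ccos (theta x - theta y))
  - Ks / 2 * (\int[mu]_(x in `[0, 1]) ccos (theta x *+ 2)).

Definition directional_local_min (E : (R -> circle R) -> R) theta : Prop :=
  forall p, L2_01 p -> exists2 eps : R, 0 < eps &
    forall h : R, `|h| < eps -> E theta <= E (perturb theta (fun x => h * p x)).

End Dynamics.

(* Main.v *)
Require Import Defs.
From HB Require Import structures.
From mathcomp Require Import all_boot all_order all_algebra.
From mathcomp Require Import all_classical all_reals all_analysis.
From mathcomp Require Import measurable_realfun.
From mathcomp Require Import ring lra.
Import Order.TTheory GRing.Theory Num.Theory.
Import numFieldNormedType.Exports.
Local Open Scope classical_set_scope.
Local Open Scope ring_scope.

Set Implicit Arguments.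
Unset Strict Implicit.
Unset Printing Implicit Defensive.

(** Put k = K / Ks, c = cos theta, s = sin theta, and let C, S be the means of
   c and s. Along the direction equal to x on D and y off D the energy is an
   explicit trigonometric polynomial in h, so minimality gives
     2 (x^2 int_D cos 2theta + y^2 int_D' cos 2theta)
       - k (int_D c int_D' c + int_D s int_D' s) (x - y)^2 >= 0.
   With y = 0 and D small this yields 2 cos 2theta - k (C c + S s) >= 0 almost
   everywhere; combined with the fixed point equation, 2 s^4 <= - k S s. If
   k S = 0 then s = 0. Otherwise k < 0 and s has the sign of S, and then the
   fixed point equation has at most one stable solution with c >= 0 and one with
   c < 0, so theta takes at most two values. For two such values the fixed point
   equations force - k = 2 cos (u - v), where u and pi - v are the two angles,
   and the quadratic form above, with D one of the two level sets, has
   discriminant proportional to - sin^2 (u - v). Hence u = v and k = - 2. *)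

(** * Two-cluster algebra *)

Section Algebra.
Context {R : realFieldType}.
Implicit Types (k C S c s x y : R).

(** The gap between the two sides is exactly [s ^+ 2] times the stability expression, once the fixed
    point equation and [c ^+ 2 + s ^+ 2 = 1] are used. *)
Lemma equilibrium_sign k C S c s : c ^+ 2 + s ^+ 2 = 1 ->
  k * (C * s - S * c) = 2 * s * c ->
  0 <= 2 * (c ^+ 2 - s ^+ 2) - k * (C * c + S * s) ->
  2 * s ^+ 4 <= - (k * S * s).
Proof.
move=> n e st; rewrite -subr_ge0.
have -> : - (k * S * s) - 2 * s ^+ 4 =
    s ^+ 2 * (2 * (c ^+ 2 - s ^+ 2) - k * (C * c + S * s)).
  have -> : s ^+ 2 * (2 * (c ^+ 2 - s ^+ 2) - k * (C * c + S * s)) =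
    2 * s ^+ 2 * c ^+ 2 - 2 * s ^+ 4 - k * (C * s - S * c) * (s * c)
     - k * S * s * (c ^+ 2 + s ^+ 2) by ring.
  rewrite e n; ring.
by rewrite mulr_ge0 // sqr_ge0.
Qed.

(** Here [kap] stands for - k. Eliminating [C] between the two equations determines [kap * S] in
    terms of the two points. If [s1 < s2], this value is too small for the stability bound at the
    second point. *)
Lemma equilibrium_unique kap C S c1 s1 c2 s2 :
  c1 ^+ 2 + s1 ^+ 2 = 1 -> c2 ^+ 2 + s2 ^+ 2 = 1 ->
  0 < s1 -> 0 < s2 -> 0 <= c1 -> 0 <= c2 ->
  kap * (S * c1 - C * s1) = 2 * s1 * c1 ->
  kap * (S * c2 - C * s2) = 2 * s2 * c2 ->
  2 * s1 ^+ 3 <= kap * S -> 2 * s2 ^+ 3 <= kap * S ->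
  c1 = c2 /\ s1 = s2.
Proof.
wlog : c1 s1 c2 s2 / s1 <= s2 => [wlg|].
  move=> n1 n2 p1 p2 q1 q2 e1 e2 l1 l2.
  have [le12|/ltW le21] := leP s1 s2; first exact: wlg.
  by have [-> ->] := wlg c2 s2 c1 s1 le21 n2 n1 p2 p1 q2 q1 e2 e1 l2 l1.
rewrite le_eqVlt => /predU1P[<-|lt12] n1 n2 p1 p2 q1 q2 e1 e2 l1 l2.
  split=> //; apply/eqP; rewrite -(eqrXn2 (n := 2)) //; apply/eqP; lra.
exfalso.
have c12 : 0 < c1 + c2 by nra.
have w12 : 0 < c1 * s2 + c2 * s1 by nra.
have E : kap * S * (c1 * s2 - c2 * s1) = 2 * (c1 - c2) * s1 * s2.
  have -> : kap * S * (c1 * s2 - c2 * s1) =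
    kap * (S * c1 - C * s1) * s2 - kap * (S * c2 - C * s2) * s1 by ring.
  by rewrite e1 e2; ring.
have dlt : 0 < s2 ^+ 2 - s1 ^+ 2 by nra.
have Ew : (c1 * s2 - c2 * s1) * (c1 * s2 + c2 * s1) = s2 ^+ 2 - s1 ^+ 2.
  have -> : (c1 * s2 - c2 * s1) * (c1 * s2 + c2 * s1) =
    c1 ^+ 2 * s2 ^+ 2 - c2 ^+ 2 * s1 ^+ 2 by ring.
  have -> : c1 ^+ 2 = 1 - s1 ^+ 2 by lra.
  have -> : c2 ^+ 2 = 1 - s2 ^+ 2 by lra.
  ring.
have Ec : (c1 - c2) * (c1 + c2) = s2 ^+ 2 - s1 ^+ 2.
  by rewrite -subr_sqr; lra.
(* Multiplying [E] by [(c1 + c2) * (c1 * s2 + c2 * s1)] turns both differences into the common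
   factor [s2 ^+ 2 - s1 ^+ 2], which then cancels. *)
have E2 : kap * S * (c1 + c2) * (s2 ^+ 2 - s1 ^+ 2) =
    2 * s1 * s2 * (c1 * s2 + c2 * s1) * (s2 ^+ 2 - s1 ^+ 2).
  rewrite -{1}Ew -{1}Ec.
  have -> : kap * S * (c1 + c2) * ((c1 * s2 - c2 * s1) * (c1 * s2 + c2 * s1))
    = kap * S * (c1 * s2 - c2 * s1) * ((c1 + c2) * (c1 * s2 + c2 * s1)) by ring.
  by rewrite E; ring.
move/(mulIf (lt0r_neq0 dlt)) in E2.
have : 2 * s2 ^+ 3 * (c1 + c2) <= kap * S * (c1 + c2) by rewrite ler_pM2r.
rewrite E2.
have -> : 2 * s2 ^+ 3 * (c1 + c2) = s2 * (2 * s2 ^+ 2 * (c1 + c2)) by ring.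
have -> : 2 * s1 * s2 * (c1 * s2 + c2 * s1) =
  s2 * (2 * s1 * (c1 * s2 + c2 * s1)) by ring.
rewrite ler_pM2l //; apply/negP; rewrite -ltNge.
have -> : 2 * s2 ^+ 2 * (c1 + c2) = 2 * s1 * (c1 * s2 + c2 * s1) +
  2 * (s2 * (s2 - s1) * c1 + (s2 ^+ 2 - s1 ^+ 2) * c2) by ring.
rewrite ltrDl mulr_gt0 //.
have d21 : 0 < s2 - s1 by rewrite subr_gt0.
have [c1p|c10] := ltP 0 c1.
  apply: ltr_wpDr; first exact: mulr_ge0 (ltW _) _.
  by rewrite !mulr_gt0.
have c2p : 0 < c2 by lra.
by apply: ltr_wpDl; rewrite ?mulr_ge0 ?mulr_gt0 // ltW.
Qed.

(** The form has diagonal entries [a + d], [b + d] and off-diagonal entry [- d]; the conclusion is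
    about its determinant. *)
Lemma qform_disc_ge0 a b d :
  (forall x y, 0 <= a * x ^+ 2 + b * y ^+ 2 + d * (x - y) ^+ 2) ->
  0 <= a * b + d * (a + b).
Proof.
move=> Q.
(* The last two points are the columns of the adjugate matrix, where the form equals a diagonal
   entry times the determinant. A negative determinant thus forces both diagonal entries to
   vanish. *)
have Q10 := Q 1 0; have Q01 := Q 0 1; have Q1 := Q d (a + d); have Q2 := Q (b + d) d.
have Q3 := Q 1 1; have Q4 := Q 1 (- 1).
rewrite leNgt; apply/negP => neg.
have E1 : a * d ^+ 2 + b * (a + d) ^+ 2 + d * (d - (a + d)) ^+ 2 =
   (a + d) * (a * b + d * (a + b)) by ring.
have E2 : a * (b + d) ^+ 2 + b * d ^+ 2 + d * (b + d - d) ^+ 2 =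
   (b + d) * (a * b + d * (a + b)) by ring.
rewrite E1 nmulr_lge0 // in Q1; rewrite E2 nmulr_lge0 // in Q2.
have a0 : a = - d by lra.
have b0 : b = - d by lra.
move: neg Q3 Q4; rewrite a0 b0 => neg Q3 Q4.
have d0 : d = 0 by lra.
by move: neg; rewrite d0; lra.
Qed.

(** [m1] and [m2] are the masses of the clusters. Each fixed point equation is conditional on a
    nonzero mass, because the values attached to an empty cluster are placeholders. If one mass
    vanishes, the equation of the other cluster gives c = 0 there, which contradicts [c2 < 0] or the
    quadratic form at (1, 1). *)
Lemma two_cluster_unstable kap m1 m2 c1 s1 c2 s2 :
  0 < kap -> kap != 2 ->
  0 <= m1 -> 0 <= m2 -> m1 + m2 = 1 ->
  c1 ^+ 2 + s1 ^+ 2 = 1 -> c2 ^+ 2 + s2 ^+ 2 = 1 ->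
  0 < s1 -> 0 < s2 -> 0 <= c1 -> c2 < 0 ->
  let C := m1 * c1 + m2 * c2 in let S := m1 * s1 + m2 * s2 in
  (m1 != 0 -> kap * (S * c1 - C * s1) = 2 * s1 * c1) ->
  (m2 != 0 -> kap * (S * c2 - C * s2) = 2 * s2 * c2) ->
  (forall x y, 0 <= 2 * (m1 * (c1 ^+ 2 - s1 ^+ 2) * x ^+ 2
                         + m2 * (c2 ^+ 2 - s2 ^+ 2) * y ^+ 2)
     + kap * (m1 * m2 * (c1 * c2 + s1 * s2)) * (x - y) ^+ 2) ->
  False.
Proof.
move=> kap0 kap2 m10 m20 m12 n1 n2 s10 s20 c10 c20 C S f1 f2 Q.
(* In terms of angles u and pi - v with (c1, s1) = (cos u, sin u) and
   (c2, s2) = (- cos v, sin v): w = sin (u + v), q = cos (u - v) and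
   r = - cos (u + v). *)
set w := s2 * c1 - c2 * s1.
have w0 : 0 < w by rewrite /w; nra.
have E1 : kap * (S * c1 - C * s1) = kap * m2 * w by rewrite /S /C /w; ring.
have E2 : kap * (S * c2 - C * s2) = - (kap * m1 * w) by rewrite /S /C /w; ring.
have [m1z|m1n] := eqVneq m1 0.
  have m21 : m2 = 1 by lra.
  have := f2; rewrite E2 m1z m21 oner_neq0 mulr0 mul0r oppr0 => /(_ isT) /esym/eqP.
  by rewrite !mulf_eq0 pnatr_eq0 (gt_eqF s20) (lt_eqF c20).
have [m2z|m2n] := eqVneq m2 0.
  have m11 : m1 = 1 by lra.
  have := f1 m1n; rewrite E1 m2z mulr0 mul0r => /esym/eqP.
  rewrite !mulf_eq0 pnatr_eq0 (gt_eqF s10) /= => /eqP c1z.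
  by have := Q 1 1; move: n1; rewrite m2z m11 c1z; lra.
have m1p : 0 < m1 by rewrite lt0r m1n.
have m2p : 0 < m2 by rewrite lt0r m2n.
have {}f1 : kap * m2 * w = 2 * s1 * c1 by rewrite -E1 f1.
have {}f2 : kap * m1 * w = - (2 * s2 * c2) by rewrite -[LHS]opprK -E2 f2.
have c1p : 0 < c1.
  have : 0 < kap * m2 * w by rewrite !mulr_gt0.
  by rewrite f1 pmulr_rgt0 // mulr_gt0.
set q := s1 * s2 - c1 * c2.
(* Adding [f1] and [f2] removes the masses; what remains is sin 2u + sin 2v = 2 sin (u + v) cos (u -
   v). *)
have kapq : kap = 2 * q.
  apply: (mulIf (lt0r_neq0 w0)).
  have -> : kap * w = kap * m2 * w + kap * m1 * w.
    by rewrite -mulrDl -mulrDr [m2 + m1]addrC m12 mulr1.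
  rewrite f1 f2 /q /w.
  have -> : 2 * (s1 * s2 - c1 * c2) * (s2 * c1 - c2 * s1) =
    2 * s1 * c1 * (c2 ^+ 2 + s2 ^+ 2) - 2 * s2 * c2 * (c1 ^+ 2 + s1 ^+ 2) by ring.
  by rewrite n1 n2; ring.
have q0 : 0 < q by rewrite /q; nra.
(* This is where the excluded parameter value enters: 1 - [q ^+ 2] is sin^2 (u - v), and [q = 1]
   would mean [kap = 2]. *)
have q1 : q ^+ 2 < 1.
  have qe : q ^+ 2 = 1 - (s1 * c2 + s2 * c1) ^+ 2.
    have -> : 1 = (c1 ^+ 2 + s1 ^+ 2) * (c2 ^+ 2 + s2 ^+ 2) :> R.
      by rewrite n1 n2 mulr1.
    rewrite /q; ring.
  rewrite qe gtrBl lt0r sqr_ge0 andbT; apply/negP => /eqP z.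
  move: qe; rewrite z subr0 => /eqP.
  rewrite sqrf_eq1 => /orP[] /eqP qq; last by lra.
  by move: kap2; rewrite kapq qq mulr1 eqxx.
have /qform_disc_ge0 : forall x y, 0 <=
    2 * m1 * (c1 ^+ 2 - s1 ^+ 2) * x ^+ 2 + 2 * m2 * (c2 ^+ 2 - s2 ^+ 2) * y ^+ 2
    + kap * (m1 * m2 * (c1 * c2 + s1 * s2)) * (x - y) ^+ 2.
  by move=> x y; have := Q x y; rewrite mulrDr !mulrA.
set disc := (X in 0 <= X).
suff -> : disc = 4 * m1 * m2 * (q ^+ 2 - 1).
  by apply/negP; rewrite -ltNge pmulr_rlt0 ?mulr_gt0 // subr_lt0.
set r := c1 * c2 + s1 * s2.
have qr : 2 * q * r = - (c1 ^+ 2 - s1 ^+ 2 + (c2 ^+ 2 - s2 ^+ 2)).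
  have -> : 2 * q * r = 2 * (s1 ^+ 2 * s2 ^+ 2 - c1 ^+ 2 * c2 ^+ 2).
    by rewrite /q /r; ring.
  have -> : s1 ^+ 2 = 1 - c1 ^+ 2 by lra.
  have -> : s2 ^+ 2 = 1 - c2 ^+ 2 by lra.
  ring.
(* After multiplication by [w], the masses occur only in [kap * m1 * w] and [kap * m2 * w], which
   [f1] and [f2] replace. This removes the masses from the determinant, up to the factor
   [m1 * m2]. *)
have mix : q * (m1 * (c1 ^+ 2 - s1 ^+ 2) + m2 * (c2 ^+ 2 - s2 ^+ 2)) = - r.
  apply: (mulIf (lt0r_neq0 w0)).
  have -> : q * (m1 * (c1 ^+ 2 - s1 ^+ 2) + m2 * (c2 ^+ 2 - s2 ^+ 2)) * w =
    ((kap * m1 * w) * (c1 ^+ 2 - s1 ^+ 2) + (kap * m2 * w) * (c2 ^+ 2 - s2 ^+ 2)) / 2.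
    by rewrite kapq; field.
  rewrite f1 f2 /r /w.
  have -> : c1 ^+ 2 = 1 - s1 ^+ 2 by lra.
  have -> : c2 ^+ 2 = 1 - s2 ^+ 2 by lra.
  have -> : (- (2 * s2 * c2) * (1 - s1 ^+ 2 - s1 ^+ 2) + 2 * s1 * c1 * (1 - s2 ^+ 2 - s2 ^+ 2)) / 2
     = - (s2 * c2) * (1 - 2 * s1 ^+ 2) + s1 * c1 * (1 - 2 * s2 ^+ 2) by field.
  have -> : - (c1 * c2 + s1 * s2) * (s2 * c1 - c2 * s1) =
     s1 * c1 * (c2 ^+ 2 - s2 ^+ 2) - s2 * c2 * (c1 ^+ 2 - s1 ^+ 2) by ring.
  have -> : c1 ^+ 2 = 1 - s1 ^+ 2 by lra.
  have -> : c2 ^+ 2 = 1 - s2 ^+ 2 by lra.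
  ring.
have -> : disc = 4 * m1 * m2 * ((c1 ^+ 2 - s1 ^+ 2) * (c2 ^+ 2 - s2 ^+ 2)
   + r * (q * (m1 * (c1 ^+ 2 - s1 ^+ 2) + m2 * (c2 ^+ 2 - s2 ^+ 2)))).
  by rewrite /disc kapq -/r; ring.
(* What remains is cos 2u cos 2v - cos^2 (u + v) = - sin^2 (u - v). *)
rewrite mix; congr (_ * _).
have -> : c1 ^+ 2 - s1 ^+ 2 = 2 * c1 ^+ 2 - 1 by lra.
have -> : c2 ^+ 2 - s2 ^+ 2 = 2 * c2 ^+ 2 - 1 by lra.
have -> : (2 * c1 ^+ 2 - 1) * (2 * c2 ^+ 2 - 1) + r * - r =
  2 * c1 ^+ 2 * c2 ^+ 2 - 2 * c1 * c2 * s1 * s2 + 1 - 2 * c1 ^+ 2 - 2 * c2 ^+ 2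
  + c1 ^+ 2 * c2 ^+ 2 - s1 ^+ 2 * s2 ^+ 2 by rewrite /r; ring.
rewrite /q.
have -> : (s1 * s2 - c1 * c2) ^+ 2 = s1 ^+ 2 * s2 ^+ 2 - 2 * c1 * c2 * s1 * s2
  + c1 ^+ 2 * c2 ^+ 2 by ring.
have -> : s1 ^+ 2 = 1 - c1 ^+ 2 by lra.
have -> : s2 ^+ 2 = 1 - c2 ^+ 2 by lra.
ring.
Qed.

End Algebra.

(** * The circle *)

Section Circle.
Context {R : realType}.
Implicit Types (a b t : circle R) (x : R).

Lemma tocircle_repr t : tocircle (repr t) = t.
Proof. exact: reprK. Qed.

Lemma csin_ccosD a b : csin (a + b) = csin a * ccos b + ccos a * csin b /\
  ccos (a + b) = ccos a * ccos b - csin a * csin b.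
Proof.
by rewrite -[a]tocircle_repr -[b]tocircle_repr -tocircleD !csin_tocircle
  !ccos_tocircle sinD cosD.
Qed.

Lemma csinD a b : csin (a + b) = csin a * ccos b + ccos a * csin b.
Proof. by case: (csin_ccosD a b). Qed.

Lemma ccosD a b : ccos (a + b) = ccos a * ccos b - csin a * csin b.
Proof. by case: (csin_ccosD a b). Qed.

Lemma csinN a : csin (- a) = - csin a.
Proof. by rewrite -[a]tocircle_repr -tocircleN !csin_tocircle sinN. Qed.

Lemma ccosN a : ccos (- a) = ccos a.
Proof. by rewrite -[a]tocircle_repr -tocircleN !ccos_tocircle cosN. Qed.

Lemma ccos2Dcsin2 a : ccos a ^+ 2 + csin a ^+ 2 = 1.
Proof. exact: cos2Dsin2. Qed.

Lemma tocircle0 : tocircle 0 = 0 :> circle R.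
Proof. by apply: (addrI (tocircle 0)); rewrite -tocircleD !addr0. Qed.

(** The cosine is 1 or - 1; translating by pi reduces the second case to the first. *)
Lemma csin_eq0 t : csin t = 0 -> t = tocircle 0 \/ t = tocircle pi.
Proof.
suff ccos1 (u : circle R) : csin u = 0 -> ccos u = 1 -> u = tocircle 0.
  move=> s0; have := norm_cos_eq1 (repr t).
  rewrite -/(ccos t) -/(csin t) s0 eqxx => /eqP.
  case: ger0P => [_ c1|_ c1]; first by left; apply: ccos1.
  right; apply/eqP; rewrite -subr_eq0; apply/eqP.
  rewrite -tocircle0; apply: ccos1.
    by rewrite csinD csinN ccosN csin_tocircle ccos_tocircle s0 sinpi; ring.
  rewrite ccosD csinN ccosN csin_tocircle ccos_tocircle s0 sinpi cospi.
  lra.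
move=> s0 c1; rewrite -[u]tocircle_repr.
(* [y] is the representative in [0, 2 pi). Cosine is injective on [0, pi]; the other half is
   reflected to it by 2 pi - y. *)
pose k := Num.floor (repr u / (2 * pi)).
pose y := repr u - k%:~R * (2 * pi).
have tp : 0 < 2 * pi :> R by rewrite mulr_gt0 // pi_gt0.
have y0 : 0 <= y.
  by rewrite subr_ge0 -ler_pdivlMr // floor_le.
have y2 : y < 2 * pi.
  have := floorD1_gt (repr u / (2 * pi)).
  by rewrite ltr_pdivrMr // intrD mulrDl mul1r ltrBlDl.
have yu : tocircle y = tocircle (repr u).
  by apply/tocircle_eqP; exists (- k); rewrite /y intrN; ring.
rewrite -yu.
have cy : cos y = 1 by rewrite -ccos_tocircle yu tocircle_repr.
have [ypi|piy] := leP y pi.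
  congr tocircle; apply: cos_inj; rewrite ?in_itv /= ?y0 ?lexx ?pi_ge0 //.
  by rewrite cos0.
have : 2 * pi - y = 0.
  apply: cos_inj; rewrite ?in_itv /= ?lexx ?pi_ge0 //; first by apply/andP; split; lra.
  rewrite cos0 cosB mulr_natl cos2pi sin2pi cy; ring.
by move=> ?; exfalso; lra.
Qed.

Lemma continuous_csin : continuous (@csin R).
Proof.
apply: repr_comp_continuous; first exact: continuous_sin.
by move=> x y /eqP xy; apply/eqP; rewrite -csin_tocircle /tocircle xy csin_tocircle.
Qed.

Lemma continuous_ccos : continuous (@ccos R).
Proof.
apply: repr_comp_continuous; first exact: continuous_cos.
by move=> x y /eqP xy; apply/eqP; rewrite -ccos_tocircle /tocircle xy ccos_tocircle.
Qed.

Lemma continuous_circle_measurable (f : circle R -> R) :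
  continuous f -> measurable_fun setT f.
Proof.
move=> /continuousP cf; apply: (measurability _ (RGenOpens.measurableE R)).
move=> _ [_ [a [b ->] <-]]; rewrite setTI; apply: sub_sigma_algebra.
exact/cf/interval_open.
Qed.

End Circle.

(** * Second-order behaviour of cosine at zero *)

Section CosLimit.
Context {R : realType}.

(** The half-angle formula makes the quotient twice the square of sin (al h / 2) / h, a difference
    quotient of [f] at 0. *)
Lemma cvg_cos_quadratic (al : R) :
  (fun h : R => (1 - cos (al * h)) / h ^+ 2) @ 0^' --> al ^+ 2 / 2.
Proof.
pose f h : R := sin (al / 2 * h).
have df : is_derive (0 : R) (1 : R) f (al / 2).
  apply: is_derive_eq; rewrite mulr0 cos0 /GRing.scale /=; ring.
have := @ex_derive _ _ _ _ _ _ _ df; have := @derive_val _ _ _ _ _ _ _ df.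
rewrite /derive /derivable => lf cf.
set g := (fun h => _) in lf cf.
have {lf cf}cg : g @ 0^' --> al / 2 by rewrite -lf.
have -> : al ^+ 2 / 2 = 2 * (al / 2 * (al / 2)) by field.
suff cM : (fun h => 2 * (g h * g h)) @ 0^' --> 2 * (al / 2 * (al / 2)).
  apply: cvg_trans cM; apply: near_eq_cvg; near=> h.
  have h0 : h != 0 by near: h; exact: nbhs_dnbhs_neq.
  rewrite /g /= /f /GRing.scale /= mulr0 sin0 subr0 addr0 mulr1.
  have -> : al * h = (al / 2 * h) *+ 2 by rewrite mulr2n; field.
  by rewrite cos_mulr2n cos2sin2 mulr2n; field.
exact: cvgM (cvg_cst _) (cvgM cg cg).
Unshelve. all: by end_near. Qed.

(** Divide by [h ^+ 2] and let h tend to 0. Three frequencies suffice: the even part of the energy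
    variation only contains x - y, 2x and 2y. *)
Lemma cos_second_order_ge0 (b1 b2 b3 a1 a2 a3 eps : R) : 0 < eps ->
  (forall h : R, `|h| < eps -> 0 <= b1 * (1 - cos (a1 * h)) +
     b2 * (1 - cos (a2 * h)) + b3 * (1 - cos (a3 * h))) ->
  0 <= b1 * a1 ^+ 2 + b2 * a2 ^+ 2 + b3 * a3 ^+ 2.
Proof.
move=> eps0 H.
suff : 0 <= b1 * (a1 ^+ 2 / 2) + b2 * (a2 ^+ 2 / 2) + b3 * (a3 ^+ 2 / 2).
  by move=> ?; lra.
have lim (b a : R) : (fun h : R => b * ((1 - cos (a * h)) / h ^+ 2)) @ 0^' -->
    b * (a ^+ 2 / 2)
    by apply: cvgM; [exact: cvg_cst|exact: cvg_cos_quadratic].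
have lim3 : (fun h : R => b1 * ((1 - cos (a1 * h)) / h ^+ 2) +
    b2 * ((1 - cos (a2 * h)) / h ^+ 2) + b3 * ((1 - cos (a3 * h)) / h ^+ 2)) @ 0^' -->
    b1 * (a1 ^+ 2 / 2) + b2 * (a2 ^+ 2 / 2) + b3 * (a3 ^+ 2 / 2).
  by apply: cvgD; [apply: cvgD|]; exact: lim.
refine (cvgr_to_ge lim3 _).
near=> h => /=.
rewrite !mulrA -!mulrDl divr_ge0 ?sqr_ge0 //.
by apply: H; near: h; exact: dnbhs0_lt.
Unshelve. all: by end_near. Qed.

End CosLimit.

(** * Bounded measurable functions on the unit interval *)

Section Integration.
Context {R : realType}.
Local Notation mu := (@lebesgue_measure R).
Local Notation I01 := (`[0, 1]%classic : set R).
Implicit Types (f g : R -> R) (D : set R) (theta : R -> circle R).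

(** Measurability is asked on [0,1] only, which is all that [Theta] provides; the global bound holds
    for sines, cosines and step functions. *)
Definition bounded_measurable f :=
  measurable_fun I01 f /\ exists M, forall x, `|f x| <= M.

Lemma bounded_measurable_cst a : bounded_measurable (fun=> a).
Proof. by split; [exact: measurable_cst|exists `|a|]. Qed.

Lemma bounded_measurableD f g : bounded_measurable f -> bounded_measurable g ->
  bounded_measurable (fun x => f x + g x).
Proof.
move=> [mf [M fM]] [mg [N gN]]; split; first exact: measurable_funD.
by exists (M + N) => x; rewrite (le_trans (ler_normD _ _)) // lerD.
Qed.

Lemma bounded_measurableM f g : bounded_measurable f -> bounded_measurable g ->
  bounded_measurable (fun x => f x * g x).
Proof.
move=> [mf [M fM]] [mg [N gN]]; split; first exact: measurable_funM.
by exists (M * N) => x; rewrite normrM ler_pM.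
Qed.

Lemma bounded_measurableB f g : bounded_measurable f -> bounded_measurable g ->
  bounded_measurable (fun x => f x - g x).
Proof.
move=> [mf [M fM]] [mg [N gN]]; split; first exact: measurable_funB.
by exists (M + N) => x; rewrite (le_trans (ler_normB _ _)) // lerD.
Qed.

Lemma bounded_measurable_sqrB f g : bounded_measurable f ->
  bounded_measurable g -> bounded_measurable (fun x => f x ^+ 2 - g x ^+ 2).
Proof.
move=> bf bg; have -> : (fun x => f x ^+ 2 - g x ^+ 2) =
    (fun x => f x * f x - g x * g x) by apply/funext => x; rewrite !expr2.
by apply: bounded_measurableB; apply: bounded_measurableM.
Qed.

Lemma mu01 : mu I01 = 1%E.
Proof. by rewrite lebesgue_measure_itv /= lte01 oppr0 adde0. Qed.

Lemma bounded_measurable_integrable f D : measurable D -> D `<=` I01 ->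
  bounded_measurable f -> mu.-integrable D (EFin \o f).
Proof.
move=> mD DI [mf [M fM]]; apply: measurable_bounded_integrable => //.
- apply: (@le_lt_trans _ _ (mu I01)); last by rewrite mu01 ltry.
  by apply: le_measure; rewrite ?inE.
- exact: measurable_funS mf.
- exists M; split; first exact: num_real.
  by move=> N MN x _; apply: le_trans (ltW MN); exact: fM.
Qed.

Definition step (a b : R) D : R -> R := fun t => if t \in D then a else b.

Lemma step_comp (h : R -> R) a b D t : h (step a b D t) = step (h a) (h b) D t.
Proof. by rewrite /step; case: ifP. Qed.

Lemma bounded_measurable_step a b D : measurable D ->
  bounded_measurable (step a b D).
Proof.
move=> mD; split; last first.
  by exists (`|a| + `|b|) => t; rewrite /step; case: ifP => _; rewrite ?lerDl ?lerDr.
apply: (measurable_funS measurableT) => //.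
apply: measurable_fun_ifT; [|exact: measurable_cst|exact: measurable_cst].
apply: (measurable_fun_bool true); rewrite setTI.
suff -> : (fun t : R => t \in D) @^-1` [set true] = D by [].
by apply/seteqP; split=> t /=; [move/set_mem|move/mem_set].
Qed.

Lemma Rintegral_split f D : measurable D -> bounded_measurable f ->
  \int[mu]_(x in I01) f x =
  \int[mu]_(x in I01 `&` D) f x + \int[mu]_(x in I01 `\` D) f x.
Proof.
move=> mD bf; rewrite -Rintegral_setU; first by rewrite setUIDK.
- exact: measurableI.
- exact: measurableD.
- rewrite setUIDK; exact: bounded_measurable_integrable.
- apply/disj_setPS => x [[_ Dx] [_]]; exact.
Qed.

Lemma Rintegral_step f a b D : measurable D -> bounded_measurable f ->
  \int[mu]_(x in I01) (f x * step a b D x) =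
  (\int[mu]_(x in I01 `&` D) f x) * a + (\int[mu]_(x in I01 `\` D) f x) * b.
Proof.
move=> mD bf; rewrite (@Rintegral_split _ D) //; last first.
  by apply: bounded_measurableM => //; exact: bounded_measurable_step.
have mI : measurable (I01 `&` D) by exact: measurableI.
have mE : measurable (I01 `\` D) by exact: measurableD.
congr (_ + _); rewrite -RintegralZr //; do ?[exact: bounded_measurable_integrable].
- by apply: eq_Rintegral => x; rewrite inE => -[_ Dx]; rewrite /step mem_set.
- by apply: eq_Rintegral => x; rewrite inE => -[_ Dx]; rewrite /step memNset.
Qed.

Lemma step_L2 a b D : measurable D -> L2_01 (step a b D).
Proof.
move=> mD; have [mf [M fM]] := bounded_measurable_step a b mD.
have mp : measurable_fun setT (step a b D \_ I01).
  by apply: (iffLR (measurable_restrictT _ _)) => //; exact: measurable_itv.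
rewrite /L2_01 /= inE; apply/andP; split; rewrite inE //=.
rewrite /finite_norm unlock /Lnorm poweR_lty //.
apply: integrable_lty => //.
have -> : (fun x => (`|(step a b D \_ I01) x| `^ 2)%:E) =
    EFin \o ((fun x => step a b D x * step a b D x) \_ I01).
  apply/funext => x /=; rewrite !patchE; case: ifP => _; last first.
    by rewrite normr0 powR0.
  by rewrite powR_mulrn // real_normK ?num_real.
rewrite -restrict_EFin; apply/integrable_restrict => //; rewrite setTI.
apply: bounded_measurable_integrable => //.
by apply: bounded_measurableM; exact: bounded_measurable_step.
Qed.

Lemma Theta_bounded_measurable theta : Theta theta ->
  bounded_measurable (fun x => ccos (theta x)) /\
  bounded_measurable (fun x => csin (theta x)).
Proof.
move=> mth; split; split.
- exact: measurableT_comp (continuous_circle_measurable continuous_ccos) mth.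
- by exists 1 => x; exact: cos_max.
- exact: measurableT_comp (continuous_circle_measurable continuous_csin) mth.
- by exists 1 => x; exact: sin_max.
Qed.

End Integration.

(** * Energy and second variation *)

Section Energy.
Context {R : realType}.
Local Notation mu := (@lebesgue_measure R).
Local Notation I01 := (`[0, 1]%classic : set R).
Variable theta : R -> circle R.
Let c x := ccos (theta x).
Let s x := csin (theta x).
Hypotheses (bc : bounded_measurable c) (bs : bounded_measurable s).

Let integrable01 f : bounded_measurable f -> mu.-integrable I01 (EFin \o f).
Proof. by move=> bf; apply: bounded_measurable_integrable. Qed.

Let integral_lin a b : \int[mu]_(x in I01) (c x * a + s x * b) =
  (\int[mu]_(x in I01) c x) * a + (\int[mu]_(x in I01) s x) * b.
Proof.
rewrite RintegralD ?RintegralZr //; apply: integrable01 => //;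
  by apply: bounded_measurableM => //; exact: bounded_measurable_cst.
Qed.

Lemma rhsE K Ks x : rhs K Ks theta x =
  K * (s x * (\int[mu]_(y in I01) c y) - c x * (\int[mu]_(y in I01) s y))
  - Ks * (2 * s x * c x).
Proof.
rewrite /rhs mulr2n csinD -/(c x) -/(s x); congr (K * _ - _); last by ring.
rewrite mulrC -mulNr [- c x * _]mulrC -integral_lin.
by apply: eq_Rintegral => y _; rewrite csinD csinN ccosN /c /s; ring.
Qed.

(** The kernel cos (u - v) separates into products, so the double integral depends only on the means
    of [c] and [s]. *)
Lemma energyE K Ks : energy K Ks theta =
  K / 2 * ((\int[mu]_(x in I01) c x) ^+ 2 + (\int[mu]_(x in I01) s x) ^+ 2)
  - Ks / 2 * (\int[mu]_(x in I01) (c x ^+ 2 - s x ^+ 2)).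
Proof.
rewrite /energy; congr (_ * _ - _ * _); last first.
  by apply: eq_Rintegral => x _; rewrite mulr2n ccosD !expr2.
rewrite !expr2 -integral_lin; apply: eq_Rintegral => y _.
rewrite [c y * _]mulrC [s y * _]mulrC -integral_lin.
by apply: eq_Rintegral => x _; rewrite ccosD csinN ccosN /c /s; ring.
Qed.

End Energy.

Section SecondVariation.
Context {R : realType}.
Local Notation mu := (@lebesgue_measure R).
Local Notation I01 := (`[0, 1]%classic : set R).
Variables (K Ks : R) (theta : R -> circle R) (D : set R).
Hypotheses (mth : Theta theta) (mD : measurable D).
Let c x := ccos (theta x).
Let s x := csin (theta x).
Let E := I01 `\` D.
Let F := I01 `&` D.
Let cos2 x := c x ^+ 2 - s x ^+ 2.
Let sin2 x := 2 * s x * c x.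
Let bc : bounded_measurable c := (Theta_bounded_measurable mth).1.
Let bs : bounded_measurable s := (Theta_bounded_measurable mth).2.

Let bcos2 : bounded_measurable cos2.
Proof. exact: bounded_measurable_sqrB. Qed.

Let bsin2 : bounded_measurable sin2.
Proof.
by do 2 apply: bounded_measurableM => //; exact: bounded_measurable_cst.
Qed.

Local Notation "'J' A f" := (\int[mu]_(x in A) f x)
  (at level 10, A at level 8, f at level 8).

Let pert h x y := perturb theta (fun t => h * step x y D t).

Let ccos_pert h x y t : ccos (pert h x y t) =
  c t * step (cos (h * x)) (cos (h * y)) D t
  - s t * step (sin (h * x)) (sin (h * y)) D t.
Proof.
rewrite ccosD ccos_tocircle csin_tocircle.
by rewrite (step_comp (fun u => cos (h * u))) (step_comp (fun u => sin (h * u))).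
Qed.

Let csin_pert h x y t : csin (pert h x y t) =
  s t * step (cos (h * x)) (cos (h * y)) D t
  + c t * step (sin (h * x)) (sin (h * y)) D t.
Proof.
rewrite csinD ccos_tocircle csin_tocircle.
by rewrite (step_comp (fun u => cos (h * u))) (step_comp (fun u => sin (h * u))).
Qed.

Let integrable_step f a b : bounded_measurable f ->
  mu.-integrable I01 (EFin \o (fun t => f t * step a b D t)).
Proof.
move=> bf; apply: bounded_measurable_integrable => //.
by apply: bounded_measurableM => //; exact: bounded_measurable_step.
Qed.

(** The perturbation rotates the field by the constant angle h x on [D] and h y off [D], so each
    partial integral is merely rotated. *)
Lemma energy_step h x y : energy K Ks (perturb theta (fun t => h * step x y D t)) =
  K / 2 * ((J F c * cos (h * x) + J E c * cos (h * y)
            - (J F s * sin (h * x) + J E s * sin (h * y))) ^+ 2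
         + (J F s * cos (h * x) + J E s * cos (h * y)
            + (J F c * sin (h * x) + J E c * sin (h * y))) ^+ 2)
  - Ks / 2 * (J F cos2 * cos (2 * (h * x)) + J E cos2 * cos (2 * (h * y))
            - (J F sin2 * sin (2 * (h * x)) + J E sin2 * sin (2 * (h * y)))).
Proof.
have bmS f a b : bounded_measurable f -> bounded_measurable (fun t => f t * step a b D t).
  by move=> bf; apply: bounded_measurableM => //; exact: bounded_measurable_step.
rewrite -/(pert h x y) energyE; last 2 first.
- rewrite (funext (ccos_pert h x y)).
  by apply: bounded_measurableB; exact: bmS.
- rewrite (funext (csin_pert h x y)).
  by apply: bounded_measurableD; exact: bmS.
congr (_ * (_ ^+ 2 + _ ^+ 2) - _ * _).
- rewrite -!Rintegral_step // -RintegralB //; do ?exact: integrable_step.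
  by apply: eq_Rintegral => t _; exact: ccos_pert.
- rewrite -!Rintegral_step // -RintegralD //; do ?exact: integrable_step.
  by apply: eq_Rintegral => t _; exact: csin_pert.
- rewrite -!Rintegral_step // -RintegralB //; do ?exact: integrable_step.
  apply: eq_Rintegral => t _; rewrite ccos_pert csin_pert /cos2 /sin2.
  have cos2E (u : R) : cos (2 * u) = cos u ^+ 2 - sin u ^+ 2.
    by rewrite mulr_natl cos_mulr2n sin2cos2; ring.
  have sin2E (u : R) : sin (2 * u) = 2 * (cos u * sin u).
    by rewrite mulr_natl sin_mulr2n; ring.
  by rewrite /step; case: ifP => _; rewrite !cos2E !sin2E; ring.
Qed.

Lemma second_variation x y :
  directional_local_min (energy K Ks) theta ->
  0 <= 2 * Ks * (J F cos2 * x ^+ 2 + J E cos2 * y ^+ 2)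
     - K * (J F c * J E c + J F s * J E s) * (x - y) ^+ 2.
Proof.
move=> /(_ _ (step_L2 x y mD))[eps eps0 Emin].
(* Writing the base point as a zero perturbation lets [energy_step] expand both sides of the
   inequality. *)
have theta0 : energy K Ks theta = energy K Ks (perturb theta (fun t => 0 * step x y D t)).
  congr energy; apply/funext => t.
  by rewrite /perturb mul0r tocircle0 addr0.
suff H : forall h, `|h| < eps -> 0 <=
   - 2 * K * (J F c * J E c + J F s * J E s) * (1 - cos ((x - y) * h))
   + Ks * J F cos2 * (1 - cos (2 * x * h)) + Ks * J E cos2 * (1 - cos (2 * y * h)).
  have := cos_second_order_ge0 eps0 H.
  move: (J F c) (J F s) (J E c) (J E s) (J F cos2) (J E cos2) => A A' B B' T T'.
  lra.
move=> h heps.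
(* Adding the inequalities at h and - h cancels the terms odd in h. *)
have := Emin h heps; have := Emin (- h); rewrite normrN => /(_ heps).
rewrite theta0 !energy_step !mul0r !mulNr !mulrN !cosN !sinN.
have -> : (x - y) * h = h * x - h * y by ring.
have -> : 2 * x * h = 2 * (h * x) by ring.
have -> : 2 * y * h = 2 * (h * y) by ring.
rewrite !mulr0 cos0 sin0 cosB.
have := cos2Dsin2 (h * x); have := cos2Dsin2 (h * y).
move: (cos (2 * _)) (cos (2 * _)) (sin (2 * _)) (sin (2 * _)) => u v u' v'.
move: (cos (h * x)) (cos (h * y)) (sin (h * x)) (sin (h * y)) => a b a' b'.
move: (J F c) (J F s) (J E c) (J E s) (J F cos2) (J E cos2) (J F sin2) (J E sin2).
move=> A A' B B' T T' U U' nb na e1 e2.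
have := lerD e1 e2; rewrite -subr_ge0; congr (0 <= _); apply/eqP.
rewrite -subr_eq0; apply/eqP.
(* The two sides agree modulo the Pythagorean identities for h x and h y. *)
transitivity (K * (A ^+ 2 + A' ^+ 2) * (a ^+ 2 + a' ^+ 2 - 1)
  + K * (B ^+ 2 + B' ^+ 2) * (b ^+ 2 + b' ^+ 2 - 1)); first by field.
by rewrite na nb !subrr !mulr0 addr0.
Qed.

End SecondVariation.

(** * Stability of fixed points *)

Section Stability.
Context {R : realType}.
Local Notation mu := (@lebesgue_measure R).
Local Notation I01 := (`[0, 1]%classic : set R).
Local Notation "'J' A f" := (\int[mu]_(x in A) f x)
  (at level 10, A at level 8, f at level 8).

Lemma Rintegral_le_measure f D : measurable D -> D `<=` I01 ->
  bounded_measurable f -> (forall x, `|f x| <= 1) -> `|J D f| <= fine (mu D).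
Proof.
move=> mD DI bf f1; have intf := bounded_measurable_integrable mD DI bf.
apply: (le_trans (@le_normr_Rintegral _ _ _ mu D f mD intf)).
rewrite -[leRHS]mul1r -(@Rintegral_cst _ _ _ mu D mD 1); apply: le_Rintegral => //.
  exact: integrable_norm.
exact/bounded_measurable_integrable/bounded_measurable_cst.
Qed.

(* A set on which [f < - e] is cut into pieces of measure so small that the
   quadratic term cannot compensate the linear one, so each piece is null. *)
Lemma ae_ge0_of_quadratic_bound f (B : R) : bounded_measurable f -> 0 <= B ->
  (forall D : set R, measurable D -> D `<=` I01 -> 0 <= J D f + B * fine (mu D) ^+ 2) ->
  {ae mu, forall x, I01 x -> 0 <= f x}.
Proof.
move=> bf B0 H.
have null (e : R) : 0 < e -> {ae mu, forall x, I01 x -> - e <= f x}.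
  move=> e0; pose N := (Num.truncn (B / e)).+1.
  have N0 : 0 < N%:R :> R by rewrite ltr0n.
  have BN : B < e * N%:R.
    by rewrite mulrC -ltr_pdivrMr // truncnS_gt.
  pose P (j : nat) : set R := (I01 `&` f @^-1` `]-oo, (- e)[) `&`
    `[j%:R / N%:R, j.+1%:R / N%:R].
  have mP j : measurable (P j).
    by apply: measurableI; [apply: bf.1|].
  have PI j : P j `<=` I01 by move=> x [[]].
  have : mu.-negligible (\bigcup_j P j).
    apply: negligible_bigcup => j; apply/negligibleP; first exact: mP.
    have mP1 : (mu (P j) <= (N%:R^-1)%:E)%E.
      have -> : (N%:R^-1)%:E = mu `[j%:R / N%:R, j.+1%:R / N%:R].
        rewrite lebesgue_measure_itv /= lte_fin ltr_pM2r ?invr_gt0 // ltr_nat ltnSn.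
        by rewrite -EFinB -mulrBl -natrB // subSnn mul1r.
      apply: le_measure; last by move=> x [].
        by apply: mem_set; exact: mP.
      by apply: mem_set; exact: measurable_itv.
    have mfin : mu (P j) \is a fin_num.
      by rewrite ge0_fin_numE // (le_lt_trans mP1) // ltry.
    apply: (etrans (esym (fineK mfin))); congr EFin.
    have m0 : 0 <= fine (mu (P j)) by rewrite fine_ge0.
    have mN : fine (mu (P j)) * N%:R <= 1.
      by rewrite -ler_pdivlMr // div1r -lee_fin fineK.
    have fj : J (P j) f <= - e * fine (mu (P j)).
      rewrite -(@Rintegral_cst _ _ _ mu _ (mP j) (- e)); apply: le_Rintegral.
      - exact: mP.
      - exact: bounded_measurable_integrable.
      - exact/bounded_measurable_integrable/bounded_measurable_cst.
      - by move=> x [[_ /=]]; rewrite in_itv /= => /ltW.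
    have := H _ (mP j) (@PI j).
    move: (fine _) (J (P j) f) m0 mN fj => m z m0 mN fj zm.
    apply/eqP; rewrite eq_le m0 andbT leNgt; apply/negP => mp.
    have : e * m * N%:R <= B * m ^+ 2 * N%:R by rewrite ler_pM2r //; lra.
    have : B * m ^+ 2 * N%:R <= B * m.
      rewrite -[leRHS]mulr1 expr2 !mulrA -mulrA ler_wpM2l //; exact: mulr_ge0.
    have : B * m < e * N%:R * m by rewrite ltr_pM2r.
    lra.
  apply: negligibleS => x /= /not_implyP[Ix /negP]; rewrite -ltNge => fx.
  have x0 : 0 <= x by move: Ix; rewrite /= in_itv /= => /andP[].
  (* The pieces are indexed by all naturals, so x = 1 falls in the piece of index [N] and needs no
     separate case. *)
  exists (Num.truncn (x * N%:R)) => //; split; first by split.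
  have /truncn_itv/andP[t1 t2] : 0 <= x * N%:R by rewrite mulr_ge0 // ltW.
  by rewrite /= in_itv /= ler_pdivrMr // ler_pdivlMr // t1 ltW.
have /ae_foralln : forall n : nat, {ae mu, forall x, I01 x -> - n.+1%:R^-1 <= f x}.
  by move=> n; apply: null; rewrite invr_gt0.
apply: filterS => x H0 Ix; rewrite leNgt; apply/negP => fx.
have [n] := ltr_add_invr fx.
by rewrite -ltrBrDr sub0r ltNge H0.
Qed.

Lemma ae_imply (P Q : R -> Prop) : (forall x, P x -> Q x) ->
  {ae mu, forall x, P x} -> {ae mu, forall x, Q x}.
Proof.
move=> PQ; apply: negligibleS => x /=.
by apply: contra_not; exact: PQ.
Qed.

Lemma ae_imply2 (P Q T : R -> Prop) : (forall x, P x -> Q x -> T x) ->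
  {ae mu, forall x, P x} -> {ae mu, forall x, Q x} -> {ae mu, forall x, T x}.
Proof.
move=> PQ p q; apply: negligibleS (negligibleU p q) => x /= nT.
apply: contrapT => /not_orP[/contrapT Px /contrapT Qx].
exact: nT (PQ x Px Qx).
Qed.

Lemma Rintegral_ae_cst (f : R -> R) (D : set R) v : measurable D -> D `<=` I01 ->
  bounded_measurable f -> {ae mu, forall x, D x -> f x = v} ->
  J D f = v * J D (fun=> 1).
Proof.
move=> mD DI bf fv.
have b1 := @bounded_measurable_cst R 1.
rewrite -(@RintegralZl _ _ _ mu D _ v mD); last first.
  exact: bounded_measurable_integrable.
have bv : bounded_measurable (fun=> v * 1 : R) by exact: bounded_measurable_cst.
congr fine; apply: ae_eq_integral => //.
- by have /integrableP[] := bounded_measurable_integrable mD DI bf.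
- suff : {ae mu, forall x, D x -> (f x)%:E = (v * 1)%:E} by [].
  by apply: (ae_imply _ fv) => x fx Dx; rewrite fx // mulr1.
Qed.

Lemma Rintegral_ae_ge0 (f : R -> R) : bounded_measurable f ->
  {ae mu, forall x, I01 x -> 0 <= f x} -> 0 <= J I01 f.
Proof.
move=> bf f0; have intf := bounded_measurable_integrable (measurable_itv _) (@subset_refl _ I01) bf.
have bn : bounded_measurable (fun x => `|f x|).
  split; first by apply: measurableT_comp => //; exact: bf.1.
  by have [_ [M fM]] := bf; exists M => x; rewrite normr_id.
have intn := bounded_measurable_integrable (measurable_itv _) (@subset_refl _ I01) bn.
have -> : J I01 f = J I01 (fun x => `|f x|).
  congr fine; apply: ae_eq_integral => //.
  - by case/integrableP : intf.
  - by case/integrableP : intn.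
  - suff : {ae mu, forall x, I01 x -> (f x)%:E = `|f x|%:E} by [].
    by apply: (ae_imply _ f0) => x fx Ix; rewrite ger0_norm // fx.
exact: Rintegral_ge0.
Qed.

(** * Stable fixed points in the variables c, s and k *)

Variables (k : R) (c s : R -> R).
Hypotheses (bc : bounded_measurable c) (bs : bounded_measurable s).
Hypothesis cs1 : forall x, c x ^+ 2 + s x ^+ 2 = 1.
Let C := J I01 c.
Let S := J I01 s.
Let cos2 x := c x ^+ 2 - s x ^+ 2.
Hypothesis fixedp :
  {ae mu, forall x, I01 x -> k * (C * s x - S * c x) = 2 * s x * c x}.
Hypothesis second : forall D, measurable D -> forall x y,
  0 <= 2 * (J (I01 `&` D) cos2 * x ^+ 2 + J (I01 `\` D) cos2 * y ^+ 2)
     - k * (J (I01 `&` D) c * J (I01 `\` D) c + J (I01 `&` D) s * J (I01 `\` D) s)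
        * (x - y) ^+ 2.

Let bcos2 : bounded_measurable cos2.
Proof. exact: bounded_measurable_sqrB. Qed.

Let c_le1 x : `|c x| <= 1.
Proof. by rewrite -(@expr_le1 _ 2) // real_normK ?num_real // -(cs1 x) lerDl sqr_ge0. Qed.

Let s_le1 x : `|s x| <= 1.
Proof. by rewrite -(@expr_le1 _ 2) // real_normK ?num_real // -(cs1 x) lerDr sqr_ge0. Qed.

(** Take x = 1, y = 0 in [second] and write the integrals off D as [C] and [S] minus those over D.
    The error term is k times the sum of the squared integrals of [c] and [s] over D, each square at
    most the squared measure of D; hence the constant 2 |k|. *)
Lemma pointwise_stable : {ae mu, forall x, I01 x ->
  0 <= 2 * cos2 x - k * (C * c x + S * s x)}.
Proof.
have b2 f a : bounded_measurable f -> bounded_measurable (fun x : R => a * f x).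
  by move=> bf; apply: bounded_measurableM => //; exact: bounded_measurable_cst.
have bl : bounded_measurable (fun x => C * c x + S * s x).
  by apply: bounded_measurableD; exact: b2.
have ba : bounded_measurable (fun x => 2 * cos2 x - k * (C * c x + S * s x)).
  by apply: bounded_measurableB; apply: b2.
apply: (ae_ge0_of_quadratic_bound (B := `|k| * 2) ba); first by rewrite mulr_ge0.
move=> D mD DI; have := second mD 1 0.
have FD : I01 `&` D = D by apply/setIidPr.
have Cs := Rintegral_split mD bc; have Ss := Rintegral_split mD bs.
rewrite -/C -/S !FD in Cs Ss; rewrite FD.
have intb f : bounded_measurable f -> mu.-integrable D (EFin \o f).
  exact: bounded_measurable_integrable.
have -> : J D (fun x => 2 * cos2 x - k * (C * c x + S * s x)) =
    2 * J D cos2 - k * (C * J D c + S * J D s).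
  rewrite -!(@RintegralZl _ _ _ mu D) //; do ?[exact: intb].
  rewrite -(@RintegralD _ _ _ mu D) //; do ?[by apply: intb; exact: b2].
  rewrite -(@RintegralZl _ _ _ mu D) //; do ?[exact: intb].
  by rewrite -(@RintegralB _ _ _ mu D) //; apply: intb; exact: b2.
have lec := Rintegral_le_measure mD DI bc c_le1.
have les := Rintegral_le_measure mD DI bs s_le1.
rewrite Cs Ss; move: lec les {Cs Ss}.
move: (J D c) (J D s) (J (I01 `\` D) c) (J (I01 `\` D) s) => a b a' b'.
move: (J D cos2) (J (I01 `\` D) cos2) (fine (mu D)) => T T' m am bm.
have m0 : 0 <= m by rewrite (le_trans _ am).
have a2 : a ^+ 2 <= m ^+ 2 by rewrite -real_normK ?num_real // lerXn2r ?nnegrE.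
have b2' : b ^+ 2 <= m ^+ 2 by rewrite -real_normK ?num_real // lerXn2r ?nnegrE.
have kab : k * (a ^+ 2 + b ^+ 2) <= `|k| * 2 * m ^+ 2.
  rewrite (le_trans (ler_norm _)) // normrM -mulrA ler_wpM2l //.
  rewrite ger0_norm ?addr_ge0 ?sqr_ge0 //; lra.
lra.
Qed.

Lemma stable_equilibrium_sin0 : k != - 2 -> {ae mu, forall x, I01 x -> s x = 0}.
Proof.
move=> k2.
have G : {ae mu, forall x, I01 x -> k * (C * s x - S * c x) = 2 * s x * c x /\
    2 * s x ^+ 4 <= - (k * S * s x)}.
  apply: (ae_imply2 _ fixedp pointwise_stable) => x fx stx Ix; split; first exact: fx.
  exact: equilibrium_sign (cs1 x) (fx Ix) (stx Ix).
have [kS0|kS] := eqVneq (k * S) 0.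
  apply: (ae_imply _ G) => x Gx Ix; have [_] := Gx Ix.
  rewrite kS0 mul0r oppr0 pmulr_rle0 // => s4.
  have : s x ^+ 4 == 0 by rewrite eq_le s4 exprn_even_ge0.
  by rewrite expf_eq0 => /eqP.
exfalso.
(* Integrating 0 <= - k S s gives - k S^2 >= 0. *)
have k0 : k < 0.
  have : 0 <= - (k * S) * S.
    rewrite -(@RintegralZl _ _ _ mu I01) //; last first.
      exact: bounded_measurable_integrable.
    apply: Rintegral_ae_ge0.
      by apply: bounded_measurableM => //; exact: bounded_measurable_cst.
    apply: (ae_imply _ G) => x Gx Ix; have [_ sx] := Gx Ix.
    by rewrite mulNr (le_trans _ sx) // mulr_ge0 // exprn_even_ge0.
  rewrite mulNr -mulrA -expr2 -mulNr pmulr_lge0 ?oppr_ge0 => [k0|].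
    by rewrite lt_neqAle k0 andbT; apply: contraNneq kS => ->; rewrite mul0r.
  by rewrite lt0r sqr_ge0 sqrf_eq0 andbT; apply: contraNneq kS => ->; rewrite mulr0.
(* The reflection of theta to - theta flips the signs of [s] and [S]; passing to [t] = [sg] s
   reduces to a positive mean sine |S|. *)
pose kap := - k; pose sg := Num.sg S.
have kap0 : 0 < kap by rewrite oppr_gt0.
have S0 : S != 0 by apply: contraNneq kS => ->; rewrite mulr0.
have sg2 : sg * sg = 1 by rewrite -expr2 sqr_sg S0.
have sgS : `|S| = sg * S by rewrite normrEsg.
have Sp : 0 < `|S| by rewrite normr_gt0.
pose t x := sg * s x.
have st x : s x = sg * t x by rewrite /t mulrA sg2 mul1r.
have ct1 x : c x ^+ 2 + t x ^+ 2 = 1.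
  by rewrite /t exprMn expr2 mulrA -expr2 [sg ^+ 2]expr2 sg2 mul1r cs1.
pose eqn c1 s1 := kap * (`|S| * c1 - C * s1) = 2 * s1 * c1.
pose ok x := [/\ 0 < t x, eqn (c x) (t x) & 2 * t x ^+ 3 <= kap * `|S|].
have {}G : {ae mu, forall x, I01 x -> ok x}.
  apply: (ae_imply _ G) => x Gx Ix; have {Gx Ix} [fx sx] := Gx Ix.
  have ex : eqn (c x) (t x).
    rewrite /eqn sgS /kap /t.
    transitivity (sg * (k * (C * s x - S * c x))); first by ring.
    by rewrite fx; ring.
  have tx : 2 * t x ^+ 4 <= kap * `|S| * t x.
    rewrite sgS /kap.
    have -> : - k * (sg * S) * t x = - (k * S * (sg * t x)) by ring.
    rewrite -st (le_trans _ sx) // /t exprMn.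
    by rewrite (_ : sg ^+ 4 = (sg * sg) * (sg * sg)); [rewrite sg2 !mul1r|ring].
  have tp : 0 < t x.
    have t0 : 0 <= t x.
      have : 0 <= kap * `|S| * t x.
        by apply: le_trans tx; rewrite mulr_ge0 // exprn_even_ge0.
      by rewrite pmulr_rge0 // mulr_gt0.
    (* If [t x] vanished, the equilibrium equation would force [c x = 0] as well, against [ct1]. *)
    rewrite lt0r t0 andbT; apply/eqP => tz.
    have := ct1 x; move: ex; rewrite /eqn tz expr0n /= addr0 !mulr0 subr0 mul0r.
    move/eqP; rewrite !mulf_eq0 (gt_eqF kap0) (gt_eqF Sp) /= => /eqP ->.
    by rewrite expr0n /= => /eqP; rewrite eq_sym oner_eq0.
  split=> //; rewrite -(ler_pM2r tp); apply: le_trans tx.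
  by rewrite -mulrA -exprSr.
(* The common value on the part with c >= 0. If no [ok] point lies there, (0, 1) is a placeholder
   meeting the sign and norm conditions. *)
have [c1 [s1 [c10 s10 n1 v1 e1]]] : exists c1 s1, [/\ 0 <= c1, 0 < s1,
    c1 ^+ 2 + s1 ^+ 2 = 1,
    (forall x, ok x -> 0 <= c x -> c x = c1 /\ t x = s1) &
    (exists x, ok x /\ 0 <= c x) -> eqn c1 s1].
  have [[y [[ty ey ly] cy]]|no] := pselect (exists x, ok x /\ 0 <= c x).
    exists (c y), (t y); split=> // x [tx ex lx] cx.
    exact: (equilibrium_unique (ct1 x) (ct1 y) tx ty cx cy ex ey lx ly).
  exists 0, 1; split=> //; first by rewrite expr0n expr1n /= add0r.
  by move=> x okx cx; case: no; exists x.
have [c2 [s2 [c20 s20 n2 v2 e2]]] : exists c2 s2, [/\ c2 < 0, 0 < s2,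
    c2 ^+ 2 + s2 ^+ 2 = 1,
    (forall x, ok x -> c x < 0 -> c x = c2 /\ t x = s2) &
    (exists x, ok x /\ c x < 0) -> eqn c2 s2].
  have [[y [[ty ey ly] cy]]|no] := pselect (exists x, ok x /\ c x < 0).
    exists (c y), (t y); split=> // x [tx ex lx] cx.
    (* Changing the signs of both [c] and [C] preserves the equation and reduces this case to
       [equilibrium_unique]. *)
    have flip z : eqn (c z) (t z) -> kap * (`|S| * - c z - - C * t z) = 2 * t z * - c z.
      by rewrite /eqn => ez; rewrite [RHS]mulrN -ez; ring.
    have nrm z : (- c z) ^+ 2 + t z ^+ 2 = 1 by rewrite sqrrN.
    have [] := equilibrium_unique (nrm x) (nrm y) tx ty _ _ (flip _ ex) (flip _ ey) lx ly.
    - by rewrite oppr_ge0 ltW.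
    - by rewrite oppr_ge0 ltW.
    - by move/oppr_inj => -> ->.
  (* A rational point of the unit circle in the required open quadrant, again a placeholder. *)
  exists (- (3 / 5)), (4 / 5); split=> //; do ?lra.
  by move=> x okx cx; case: no; exists x.
pose D := I01 `&` c @^-1` `[0, +oo[.
have mD : measurable D by apply: bc.1.
have DI : D `<=` I01 by move=> x [].
pose E := I01 `\` D.
have mE : measurable E by apply: measurableD.
have EI : E `<=` I01 by move=> x [].
have FD : I01 `&` D = D by apply/setIidPr.
have Dc x : D x -> 0 <= c x by move=> [_ /=]; rewrite in_itv /= andbT.
have Ec x : E x -> c x < 0.
  by move=> [Ix nD]; rewrite ltNge; apply/negP => cx; apply: nD; split; rewrite //= in_itv /= cx.
have b1 := @bounded_measurable_cst R 1.
pose m1 := J D (fun=> 1); pose m2 := J E (fun=> 1).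
have valD f v : bounded_measurable f -> (forall x, ok x -> 0 <= c x -> f x = v) ->
    J D f = v * m1.
  move=> bf fv; apply: Rintegral_ae_cst => //.
  by apply: (ae_imply _ G) => x Gx Dx; apply: fv; [exact/Gx/DI|exact: Dc].
have valE f v : bounded_measurable f -> (forall x, ok x -> c x < 0 -> f x = v) ->
    J E f = v * m2.
  move=> bf fv; apply: Rintegral_ae_cst => //.
  by apply: (ae_imply _ G) => x Gx Dx; apply: fv; [exact/Gx/EI|exact: Ec].
have cD : J D c = c1 * m1 by apply: valD => // x okx cx; have [] := v1 x okx cx.
have cE : J E c = c2 * m2 by apply: valE => // x okx cx; have [] := v2 x okx cx.
have sD : J D s = sg * s1 * m1.
  by apply: valD => // x okx cx; have [_ <-] := v1 x okx cx.
have sE : J E s = sg * s2 * m2.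
  by apply: valE => // x okx cx; have [_ <-] := v2 x okx cx.
have sgsq z : (sg * z) ^+ 2 = z ^+ 2 by rewrite exprMn expr2 sg2 mul1r.
have TD : J D cos2 = (c1 ^+ 2 - s1 ^+ 2) * m1.
  by apply: valD => // x okx cx; have [<- <-] := v1 x okx cx; rewrite /cos2 sgsq.
have TE : J E cos2 = (c2 ^+ 2 - s2 ^+ 2) * m2.
  by apply: valE => // x okx cx; have [<- <-] := v2 x okx cx; rewrite /cos2 sgsq.
have m12 : m1 + m2 = 1.
  have := Rintegral_split mD b1; rewrite FD -/E -/m1 -/m2 => <-.
  by rewrite (@Rintegral_cst _ _ _ mu) // mul1r; exact: (congr1 fine mu01).
have Cs := Rintegral_split mD bc; have Ss := Rintegral_split mD bs.
rewrite FD -/E -/C cD cE in Cs; rewrite FD -/E -/S sD sE in Ss.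
have aS : `|S| = m1 * s1 + m2 * s2.
  rewrite sgS Ss; transitivity (sg * sg * (m1 * s1 + m2 * s2)); first by ring.
  by rewrite sg2 mul1r.
have aC : C = m1 * c1 + m2 * c2 by rewrite Cs; ring.
apply: (@two_cluster_unstable _ kap m1 m2 c1 s1 c2 s2) => //.
- by apply: contraNneq k2 => <-; rewrite opprK.
- by apply: Rintegral_ge0.
- by apply: Rintegral_ge0.
- rewrite -aC -aS => m1n; apply: e1; apply: contrapT => no.
  (* Without [ok] points in this part, [valD] holds vacuously for any value; the value 0 for the
     constant function 1 shows that the mass is zero. *)
  move/eqP: m1n; apply; rewrite /m1 -[RHS](mul0r m1); apply: valD => // x okx cx.
  by case: no; exists x.
- rewrite -aC -aS => m2n; apply: e2; apply: contrapT => no.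
  move/eqP: m2n; apply; rewrite /m2 -[RHS](mul0r m2); apply: valE => // x okx cx.
  by case: no; exists x.
move=> x y; have := second mD x y; rewrite FD -/E TD TE cD cE sD sE.
congr (0 <= _); rewrite /kap.
have -> : sg * s1 * m1 * (sg * s2 * m2) = sg * sg * (s1 * m1 * (s2 * m2)) by ring.
by rewrite sg2; ring.
Qed.

End Stability.

(** * From a vanishing sine to the angles 0 and pi *)

Theorem theorem5p2 (R : realType) (K Ks : R) (theta : R -> circle R)
  (Ks_gt0 : 0 < Ks) (K_neq : K / Ks != - 2)
  (theta_state : Theta theta)
  (theta_fixed : fixed_point K Ks theta)
  (theta_min : directional_local_min (energy K Ks) theta) :
  {ae @lebesgue_measure R, forall x, x \in `[0, 1] ->
    theta x = tocircle 0 \/ theta x = tocircle pi}.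
Proof.
have [bc bs] := Theta_bounded_measurable theta_state.
have Ks0 : Ks != 0 by rewrite gt_eqF.
(* Factoring out Ks > 0 puts the fixed point equation and the second variation in terms of k = K /
   Ks alone. *)
have KE : K = Ks * (K / Ks) by rewrite mulrC divfK.
apply: (ae_imply _ (@stable_equilibrium_sin0 R (K / Ks)
  (fun x => ccos (theta x)) (fun x => csin (theta x)) bc bs _ _ _ K_neq)).
- by move=> x sx /sx; exact: csin_eq0.
- by move=> x; exact: ccos2Dcsin2.
- apply: (ae_imply _ theta_fixed) => x fx /fx; rewrite rhsE // {1}KE -mulrA -mulrBr => /eqP.
  rewrite mulf_eq0 (negbTE Ks0) subr_eq0 /= => /eqP <-.
  by congr (_ * (_ - _)); rewrite mulrC.
- move=> D mD x y; have := second_variation theta_state mD x y theta_min.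
  rewrite [2 * Ks]mulrC {1}KE -!mulrA -mulrBr pmulr_rge0 //.
Qed.
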